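(* Let $b>0$ and let $C_\omega\in\mathbb R$ with $C_\omega\neq0$. Then the purely rotational velocity field given by $F\equiv0$, $G\equiv0$, $\Omega\equiv C_\omega$, i.e. $$v_R\equiv0,\qquad v_\alpha\equiv0,\qquad v_\theta=\frac{C_\omega}{r^b},\qquad r=R\sin\alpha,$$ is, for a suitable scalar pressure $p$, a solution of the steady incompressible Euler equations $$(\mathbf v\cdot\nabla)\mathbf v=-\nabla p,\qquad \nabla\cdot\mathbf v=0$$ in $\{R>0,\ 0<\alpha<\pi/2\}$.
   Context: Spherical coordinates $(R,\alpha,\theta)$ on $\mathbb R^3$: $R$ is the distance to the origin, $\alpha$ is the angle between the radius vector and the positive $z$-axis, and $\theta$ is the meridian angle about the $z$-axis. The components $v_R,v_\alpha,v_\theta$ of $\mathbf v$ are taken with respect to the orthonormal spherical frame $(\mathbf e_R,\mathbf e_\alpha,\mathbf e_\theta)$, and $r=R\sin\alpha$ is the distance to the $z$-axis. The general ansatz considered is $v_R=G(x)/r^b$, $v_\alpha=F(x)/r^b$, $v_\theta=\Omega(x)/r^b$ with $x=\cos\alpha\in(0,1)$. *)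

(* Defs.v *)
From mathcomp Require Import all_boot all_order all_algebra.
From mathcomp Require Import all_classical all_reals all_analysis.
From mathcomp Require Import ring lra.

Set Implicit Arguments.
Unset Strict Implicit.
Unset Printing Implicit Defensive.

Import Order.TTheory GRing.Theory Num.Theory.
Import numFieldNormedType.Exports.

Local Open Scope classical_set_scope.
Local Open Scope ring_scope.

(* Points and vectors of the three-dimensional space are Cartesian row vectors;
   the sup norm carried by 'rV[K]_3 is only used for its topology, the
   Euclidean distance to the origin being [radius]. *)

Definition vec3 (K : realType) (x y z : K) : 'rV[K]_3 :=
  \row_(i < 3) nth 0 [:: x; y; z] i.

Definition cx (K : realType) (X : 'rV[K]_3) : K := X 0 (inord 0).
Definition cy (K : realType) (X : 'rV[K]_3) : K := X 0 (inord 1).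
Definition cz (K : realType) (X : 'rV[K]_3) : K := X 0 (inord 2).

Definition radius (K : realType) (X : 'rV[K]_3) : K :=
  Num.sqrt (cx X ^+ 2 + cy X ^+ 2 + cz X ^+ 2).

Definition polar_angle (K : realType) (X : 'rV[K]_3) : K :=
  acos (cz X / radius X).

(* The determination of the meridian angle in ]-pi, pi]. Its jump across a
   half-plane is harmless: only its sine and cosine enter the frame below. *)
Definition meridian_angle (K : realType) (X : 'rV[K]_3) : K :=
  let t := acos (cx X / Num.sqrt (cx X ^+ 2 + cy X ^+ 2)) in
  if 0 <= cy X then t else - t.

Definition spherical_point (K : realType) (rho alpha theta : K) : 'rV[K]_3 :=
  vec3 (rho * sin alpha * cos theta) (rho * sin alpha * sin theta)
       (rho * cos alpha).

Definition e_radius (K : realType) (alpha theta : K) : 'rV[K]_3 :=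
  vec3 (sin alpha * cos theta) (sin alpha * sin theta) (cos alpha).
Definition e_polar (K : realType) (alpha theta : K) : 'rV[K]_3 :=
  vec3 (cos alpha * cos theta) (cos alpha * sin theta) (- sin alpha).
Definition e_meridian (K : realType) (theta : K) : 'rV[K]_3 :=
  vec3 (- sin theta) (cos theta) 0.

(* The vector field whose components in the spherical frame are the given
   functions of the spherical coordinates (rho, alpha, theta). *)
Definition spherical_field (K : realType) (v_R v_alpha v_theta : K -> K -> K -> K)
    (X : 'rV[K]_3) : 'rV[K]_3 :=
  let rho := radius X in
  let alpha := polar_angle X in
  let theta := meridian_angle X in
  v_R rho alpha theta *: e_radius alpha theta
  + v_alpha rho alpha theta *: e_polar alpha theta
  + v_theta rho alpha theta *: e_meridian theta.

Definition ansatz (K : realType) (b : K) (G F Omega : K -> K) :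
    'rV[K]_3 -> 'rV[K]_3 :=
  spherical_field
    (fun rho alpha _ => G (cos alpha) / (rho * sin alpha) `^ b)
    (fun rho alpha _ => F (cos alpha) / (rho * sin alpha) `^ b)
    (fun rho alpha _ => Omega (cos alpha) / (rho * sin alpha) `^ b).

Definition upper_region (K : realType) : set 'rV[K]_3 :=
  [set X | 0 < radius X /\ 0 < polar_angle X < pi / 2].

Definition partial (K : realType) (V : normedModType K) (i : 'I_3)
    (f : 'rV[K]_3 -> V) (X : 'rV[K]_3) : V :=
  'D_(delta_mx 0 i) f X.

Definition gradient (K : realType) (p : 'rV[K]_3 -> K) (X : 'rV[K]_3) :
    'rV[K]_3 :=
  \row_(i < 3) partial i p X.

Definition divergence (K : realType) (v : 'rV[K]_3 -> 'rV[K]_3)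
    (X : 'rV[K]_3) : K :=
  \sum_(i < 3) partial i (fun Y => v Y 0 i) X.

(* (v . nabla) w *)
Definition advection (K : realType) (v w : 'rV[K]_3 -> 'rV[K]_3)
    (X : 'rV[K]_3) : 'rV[K]_3 :=
  \sum_(i < 3) v X 0 i *: partial i w X.

(* Meant for open D, where the partial derivatives at the points of D only
   depend on f restricted to D. *)
Definition C1_on (K : realType) (V : normedModType K) (D : set 'rV[K]_3)
    (f : 'rV[K]_3 -> V) : Prop :=
  forall X, D X -> differentiable f X /\
    forall i : 'I_3, {for X, continuous (partial i f)}.

Definition steady_euler_on (K : realType) (D : set 'rV[K]_3)
    (v : 'rV[K]_3 -> 'rV[K]_3) (p : 'rV[K]_3 -> K) : Prop :=
  [/\ C1_on D v, C1_on D p &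
      forall X, D X ->
        advection v v X = - gradient p X /\ divergence v X = 0].

Section SphericalCoordinates.
Variable K : realType.
Implicit Type X : 'rV[K]_3.

Lemma vec3_coord X : X = vec3 (cx X) (cy X) (cz X).
Proof.
apply/rowP => i; rewrite mxE.
by case: i => -[|[|[|//]]] h /=; congr (X 0 _); apply: val_inj; rewrite /= inordK.
Qed.

Lemma acos_ratio_bound (a c : K) : 0 < c -> a ^+ 2 <= c ^+ 2 -> -1 <= a / c <= 1.
Proof.
move=> c0 ac; rewrite -ler_norml normrM normfV (gtr0_norm c0) ler_pdivrMr// mul1r.
by rewrite -(ger0_norm (ltW c0)) -ler_sqr ?nnegrE ?normr_ge0// !real_normK ?num_real.
Qed.

(* R = radius, alpha = polar_angle and theta = meridian_angle are spherical
   coordinates of every point off the z-axis, and r = R sin alpha is the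
   distance to that axis. *)
Lemma radius_sin_polar_angle X : 0 < radius X ->
  radius X * sin (polar_angle X) = Num.sqrt (cx X ^+ 2 + cy X ^+ 2).
Proof.
move=> R0.
have R2 : radius X ^+ 2 = cx X ^+ 2 + cy X ^+ 2 + cz X ^+ 2.
  by rewrite sqr_sqrtr// !addr_ge0// sqr_ge0.
rewrite /polar_angle sin_acos; last first.
  by apply: acos_ratio_bound => //; rewrite R2 lerDr addr_ge0// sqr_ge0.
rewrite -{1}(gtr0_norm R0) -sqrtr_sqr -sqrtrM ?sqr_ge0//; congr Num.sqrt.
rewrite mulrBr mulr1 exprMn exprVn mulrCA mulfV ?mulr1; last first.
  by rewrite expf_neq0// gt_eqF.
by rewrite R2; ring.
Qed.

Lemma spherical_pointK X : 0 < cx X ^+ 2 + cy X ^+ 2 ->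
  spherical_point (radius X) (polar_angle X) (meridian_angle X) = X.
Proof.
move=> r20.
have R0 : 0 < radius X by rewrite sqrtr_gt0 ltr_pwDl// sqr_ge0.
have R2 : radius X ^+ 2 = cx X ^+ 2 + cy X ^+ 2 + cz X ^+ 2.
  by rewrite sqr_sqrtr// !addr_ge0// sqr_ge0.
rewrite /spherical_point radius_sin_polar_angle// [RHS]vec3_coord.
set r := Num.sqrt _.
have r0 : 0 < r by rewrite sqrtr_gt0.
have r2 : r ^+ 2 = cx X ^+ 2 + cy X ^+ 2 by rewrite sqr_sqrtr// ltW.
have bx : -1 <= cx X / r <= 1.
  by apply: acos_ratio_bound => //; rewrite r2 lerDl sqr_ge0.
have cosm : r * cos (meridian_angle X) = cx X.
  have -> : cos (meridian_angle X) = cx X / r.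
    rewrite /meridian_angle -/r; case: ifP => _; rewrite ?cosN acosK//.
  by rewrite mulrC divfK// gt_eqF.
have sina : r * sin (acos (cx X / r)) = `|cy X|.
  rewrite sin_acos// -{1}(gtr0_norm r0) -sqrtr_sqr -sqrtrM ?sqr_ge0//.
  rewrite -sqrtr_sqr; congr Num.sqrt.
  rewrite mulrBr mulr1 exprMn exprVn mulrCA mulfV ?mulr1; last first.
    by rewrite expf_neq0// gt_eqF.
  by rewrite r2; ring.
have sinm : r * sin (meridian_angle X) = cy X.
  rewrite /meridian_angle -/r; case: ifPn => [y0|]; first by rewrite sina ger0_norm.
  by rewrite -ltNge => y0; rewrite sinN mulrN sina ltr0_norm// opprK.
have cosp : radius X * cos (polar_angle X) = cz X.
  rewrite /polar_angle acosK; first by rewrite mulrC divfK// gt_eqF.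
  by apply: acos_ratio_bound => //; rewrite R2 lerDr addr_ge0// sqr_ge0.
by rewrite cosm sinm cosp.
Qed.

End SphericalCoordinates.

(* Main.v *)
Require Import Defs.
From mathcomp Require Import all_boot all_order all_algebra.
From mathcomp Require Import all_classical all_reals all_analysis.
From mathcomp Require Import ring.

Import Order.TTheory GRing.Theory Num.Theory.
Import numFieldNormedType.Exports.

Local Open Scope ring_scope.

(* Off the z-axis the field is C s^(-(b+1)/2) (-y, x, 0) with s = x^2 + y^2, hence
   smooth across the cut of the meridian angle. The rotation (-y, x, 0) is divergence
   free and tangent to the level sets of s, so the field is divergence free and its
   acceleration is -C^2 s^(-b-1) (x, y, 0), which is balanced by the pressure
   p = -C^2 / (2b) s^(-b). *)

(** * Rules for differentials *)

Section Differentials.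
Context {K : realType} {V W : normedModType K}.

(** A differential depends only on the germ at x: the first-order expansion of f at x is also one of
    g, and an expansion with continuous linear part determines the differential. *)
Lemma near_eq_is_diff (f g df : V -> W) (x : V) :
  (\near x, f x = g x) -> is_diff x f df -> is_diff x g df.
Proof.
move=> fg dfx.
have fgx : f x = g x by exact: nbhs_singleton fg.
have dfE : 'd f x = df :> (V -> W) by exact: diff_val.
have [dfc fE] := (diff_locallyP x f).1 (@ex_diff _ _ _ _ _ _ _ dfx).
have gE : g \o shift x = cst (g x) + 'd f x +o_ (0 : V) id.
  apply/eqaddoP => e e0; move/eqaddoP: fE => /(_ e e0).
  have fg0 : \forall y \near (0 : V), f (y + x) = g (y + x).
    by move: fg; rewrite (near_shift 0) subr0.
  by apply: filterS2 fg0 => y fgy; rewrite !fctE /= fgx fgy.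
have dgE : 'd g x = 'd f x :> (V -> W) by exact: diff_unique dfc gE.
apply: DiffDef; last by rewrite dgE.
by apply/diff_locallyP; rewrite dgE.
Qed.

Lemma is_diff_ext (f g df dg : V -> W) (x : V) :
  f =1 g -> df =1 dg -> is_diff x f df -> is_diff x g dg.
Proof. by move=> /funext -> /funext ->. Qed.

Lemma is_diff_scale_vec (h dh : V -> K) (c : W) (x : V) :
  is_diff x h dh -> is_diff x (fun y => h y *: c) (fun y => dh y *: c).
Proof.
move=> dhx.
exact: (@is_diff_comp _ _ _ _ h dh ( *:%R ^~ c) ( *:%R ^~ c)).
Qed.

Lemma is_diff_powR (f df : V -> K) (a : K) (x : V) : 0 < f x ->
  is_diff x f df ->
  is_diff x (fun y => f y `^ a) (fun y => a * f x `^ (a - 1) * df y).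
Proof.
move=> fx0 dfx.
have [dp pE] := @is_derive1_powR K a _ fx0.
have /derivable1_diffP dp' := dp.
have dpx : is_diff (f x) (fun t : K => t `^ a) (fun t => a * f x `^ (a - 1) * t).
  apply: DiffDef => //; apply/funext => t.
  (* By linearity the differential at t is t times its value at 1, which is the derivative. *)
  rewrite -[t in LHS](mulr1 t) [LHS]linearZ/= -deriveE// pE.
  by rewrite /GRing.scale/= mulrC.
exact: (@is_diff_comp _ _ _ _ f df (fun t : K => t `^ a) (fun t => a * f x `^ (a - 1) * t)).
Qed.

End Differentials.

(** * Cartesian coordinates and partial derivatives *)

Section Coordinates.
Context {K : realType}.
Implicit Types X Y : 'rV[K]_3.

Lemma is_diff_coord (i : 'I_3) X :
  is_diff X (fun Y : 'rV[K]_3 => Y 0 i : K) (fun Y => Y 0 i).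
Proof.
apply: DiffDef; first exact: differentiable_coord.
(* Repackaged as a linear map, the continuous coordinate function is its own differential. *)
have @f : {linear 'rV[K]_3 -> K}.
  by exists (fun N : 'rV[K]_3 => N 0 i); do 2![eexists]; do ?[constructor];
     rewrite ?mxE// => ? *; rewrite ?mxE//; move=> ?; rewrite !mxE.
rewrite (_ : (fun _ => _) = f)//.
by rewrite diff_lin//; exact: coord_continuous.
Qed.

Lemma is_diff_component {f df : 'rV[K]_3 -> 'rV[K]_3} {X} (i : 'I_3) :
  is_diff X f df -> is_diff X (fun Y => f Y 0 i : K) (fun Y => df Y 0 i).
Proof.
move=> dfX; have dc := is_diff_coord i (f X).
exact: (@is_diff_comp _ _ _ _ f df (fun Y : 'rV[K]_3 => Y 0 i : K)
         (fun Y : 'rV[K]_3 => Y 0 i)).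
Qed.

Lemma partial_is_diff {V : normedModType K} (f df : 'rV[K]_3 -> V) (i : 'I_3) X :
  is_diff X f df -> partial i f X = df (delta_mx 0 i).
Proof. by move=> dfX; rewrite /partial deriveE// diff_val. Qed.

(** Since U is open, each partial derivative agrees near a point of U with the explicit expression
    from [df], and so inherits its continuity. *)
Lemma C1_on_is_diff {V : normedModType K} (D U : set 'rV[K]_3)
    (f : 'rV[K]_3 -> V) (df : 'rV[K]_3 -> 'rV[K]_3 -> V) :
  open U -> (D `<=` U)%classic -> (forall X, U X -> is_diff X f (df X)) ->
  (forall X i, U X -> {for X, continuous (fun Y => df Y (delta_mx 0 i))}) ->
  C1_on D f.
Proof.
move=> oU DU dfE dfc X /DU UX; have dfX := dfE X UX; split; first exact: ex_diff.
move=> i; rewrite /prop_for /continuous_at (partial_is_diff _ _ i _ (dfE X UX)).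
have nE : {near X, (fun Y => df Y (delta_mx 0 i)) =1 partial i f}.
  have nU : \forall Y \near X, U Y by exact: open_nbhs_nbhs.
  by apply: filterS nU => Y UY; rewrite (partial_is_diff _ _ _ _ (dfE Y UY)).
exact: cvg_trans (near_eq_cvg nE) (dfc X i UX).
Qed.

Lemma eq_row3 X Y : cx X = cx Y -> cy X = cy Y -> cz X = cz Y -> X = Y.
Proof. by move=> *; rewrite [X]vec3_coord [Y]vec3_coord; congr vec3. Qed.

Lemma sum_ord3 (V : nmodType) (F : 'I_3 -> V) :
  \sum_(i < 3) F i = F (inord 0) + F (inord 1) + F (inord 2).
Proof.
rewrite !big_ord_recl big_ord0 addr0 addrA.
by congr (F _ + F _ + F _); apply: val_inj; rewrite /= inordK.
Qed.

(** The product of equations lets a single [rewrite] reduce all three coordinates; the same form is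
    used for the next lemmas. *)
Lemma coordD X Y : ((cx (X + Y) = cx X + cx Y)%R * (cy (X + Y) = cy X + cy Y)%R
  * (cz (X + Y) = cz X + cz Y)%R)%type.
Proof. by rewrite /cx /cy /cz !mxE. Qed.

Lemma coordN X : ((cx (- X) = - cx X)%R * (cy (- X) = - cy X)%R
  * (cz (- X) = - cz X)%R)%type.
Proof. by rewrite /cx /cy /cz !mxE. Qed.

Lemma coordZ (a : K) X : ((cx (a *: X) = a * cx X)%R * (cy (a *: X) = a * cy X)%R
  * (cz (a *: X) = a * cz X)%R)%type.
Proof. by rewrite /cx /cy /cz !mxE. Qed.

Lemma coord_vec3 (x y z : K) : ((cx (vec3 x y z) = x)%R * (cy (vec3 x y z) = y)%R
  * (cz (vec3 x y z) = z)%R)%type.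
Proof. by rewrite /cx /cy /cz !mxE !inordK. Qed.

Lemma delta_vec3 : ((delta_mx 0 (inord 0) = vec3 1 0 0 :> 'rV[K]_3)
  * (delta_mx 0 (inord 1) = vec3 0 1 0 :> 'rV[K]_3)
  * (delta_mx 0 (inord 2) = vec3 0 0 1 :> 'rV[K]_3))%type.
Proof.
by do ?split; apply: eq_row3; rewrite coord_vec3 /cx /cy /cz mxE -!val_eqE /= !inordK.
Qed.

End Coordinates.

(** * The rotational field in Cartesian form *)

Section Rotation.
Context {K : realType}.
Implicit Types X Y H : 'rV[K]_3.

Definition axis_dist2 X : K := cx X ^+ 2 + cy X ^+ 2.

Definition off_axis : set 'rV[K]_3 := [set X | 0 < axis_dist2 X]%classic.

Definition axis_dist2_diff X H : K := 2 * (cx X * cx H + cy X * cy H).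

Lemma is_diff_axis_dist2 X : is_diff X axis_dist2 (axis_dist2_diff X).
Proof.
have dx := is_diff_coord (inord 0) X.
have dy := is_diff_coord (inord 1) X.
have dM := is_diffD (is_diffM dx dx) (is_diffM dy dy).
apply: is_diff_ext dM => Y.
  by rewrite /axis_dist2 /cx /cy !expr2.
by rewrite /axis_dist2_diff /cx /cy !fctE /GRing.scale /=; ring.
Qed.

Lemma continuous_axis_dist2 X : {for X, continuous axis_dist2}.
Proof.
have ds := is_diff_axis_dist2 X.
exact/differentiable_continuous/(@ex_diff _ _ _ _ _ _ _ ds).
Qed.

Lemma open_off_axis : open off_axis.
Proof.
apply: (@open_comp _ _ axis_dist2 [set x : K | 0 < x]%classic); last exact: open_gt.
by move=> X _; exact: continuous_axis_dist2.
Qed.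

(** The distance to the axis is R sin alpha, which is positive because R > 0 and 0 < alpha < pi / 2
    < pi. *)
Lemma upper_region_off_axis : (@upper_region K `<=` off_axis)%classic.
Proof.
move=> X [R0 /andP[a0 api]]; rewrite /off_axis /= /axis_dist2 -sqrtr_gt0.
rewrite -radius_sin_polar_angle// mulr_gt0// sin_gt0_pi// a0/=.
by apply: lt_trans api _; rewrite ltr_pdivrMr// ltr_pMr ?pi_gt0// ltr1n.
Qed.

(* [swirl c k] is the field [c r^(2k) (-y, x, 0)]. *)
Definition swirl (c k : K) X : 'rV[K]_3 :=
  (- (c * axis_dist2 X `^ k * cy X)) *: vec3 1 0 0
  + (c * axis_dist2 X `^ k * cx X) *: vec3 0 1 0.

(** The differential of c s^k in direction H, with s = [axis_dist2]; it serves both the coefficient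
    of the field and the pressure. *)
Definition scaled_powR_diff (c k : K) X H : K :=
  c * (k * axis_dist2 X `^ (k - 1) * axis_dist2_diff X H).

Definition swirl_diff (c k : K) X H : 'rV[K]_3 :=
  (- (scaled_powR_diff c k X H * cy X + c * axis_dist2 X `^ k * cy H)) *: vec3 1 0 0
  + (scaled_powR_diff c k X H * cx X + c * axis_dist2 X `^ k * cx H) *: vec3 0 1 0.

Lemma is_diff_scaled_powR (c k : K) X : off_axis X ->
  is_diff X (fun Y => c * axis_dist2 Y `^ k) (scaled_powR_diff c k X).
Proof.
move=> UX; have dp := is_diff_powR _ _ k _ UX (is_diff_axis_dist2 X).
exact: is_diff_ext (is_diffZ c dp).
Qed.

Lemma is_diff_swirl (c k : K) X : off_axis X ->
  is_diff X (swirl c k) (swirl_diff c k X).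
Proof.
move=> UX; have dh := is_diff_scaled_powR c k X UX.
have dx := is_diff_coord (inord 0) X.
have dy := is_diff_coord (inord 1) X.
have d0 := is_diff_scale_vec _ _ (vec3 1 0 0 : 'rV[K]_3) _ (is_diffN (is_diffM dh dy)).
have d1 := is_diff_scale_vec _ _ (vec3 0 1 0 : 'rV[K]_3) _ (is_diffM dh dx).
apply: is_diff_ext (is_diffD d0 d1) => Y //.
rewrite /swirl_diff /cx /cy /=; congr (_ *: _ + _ *: _);
  by rewrite !fctE /GRing.scale /=; ring.
Qed.

Lemma continuous_axis_dist2_powR (k : K) X : off_axis X ->
  {for X, continuous (fun Y => axis_dist2 Y `^ k)}.
Proof.
move=> UX; have dp := is_diff_powR _ _ k _ UX (is_diff_axis_dist2 X).
exact/differentiable_continuous/(@ex_diff _ _ _ _ _ _ _ dp).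
Qed.

Lemma continuous_scaled_powR_diff (c k : K) H X : off_axis X ->
  {for X, continuous (fun Y => scaled_powR_diff c k Y H)}.
Proof.
move=> UX; rewrite /scaled_powR_diff /axis_dist2_diff.
have cc (i : 'I_3) : {for X, continuous (fun Y : 'rV[K]_3 => Y 0 i)}.
  exact: coord_continuous.
apply: continuousM; first exact: cst_continuous.
apply: continuousM.
  by apply: continuousM; [exact: cst_continuous|exact: continuous_axis_dist2_powR].
apply: continuousM; first exact: cst_continuous.
by apply: continuousD; apply: continuousM; first [exact: cst_continuous|exact: cc].
Qed.

Lemma continuous_swirl_diff (c k : K) H X : off_axis X ->
  {for X, continuous (fun Y => swirl_diff c k Y H)}.
Proof.
move=> UX; rewrite /swirl_diff.
(* Both coefficients have this shape, the first one up to sign. *)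
have cs (i j : 'I_3) : {for X, continuous (fun Y : 'rV[K]_3 =>
    scaled_powR_diff c k Y H * Y 0 i + c * axis_dist2 Y `^ k * H 0 j)}.
  apply: continuousD; apply: continuousM.
  - exact: continuous_scaled_powR_diff.
  - exact: coord_continuous.
  - by apply: continuousM; [exact: cst_continuous|exact: continuous_axis_dist2_powR].
  - exact: cst_continuous.
apply: continuousD; apply: continuousZ; try exact: cst_continuous; last exact: cs.
by apply: continuousN; exact: cs.
Qed.

(** With r = R sin alpha, x = r cos theta and y = r sin theta, the meridian vector is (-y, x, 0) /
    r, and r^(-b) / r = s^(-(b+1)/2). *)
Lemma ansatz_swirl (b C : K) X : off_axis X ->
  ansatz b (fun _ => 0) (fun _ => 0) (fun _ => C) X = swirl C (- (b + 1) / 2) X.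
Proof.
move=> UX; have XE := spherical_pointK UX.
have R0 : 0 < Defs.radius X.
  by rewrite sqrtr_gt0 ltr_pwDl// sqr_ge0.
have rE := radius_sin_polar_angle R0.
have r0 : 0 < Defs.radius X * sin (polar_angle X) by rewrite rE sqrtr_gt0.
have [xE yE] : Defs.radius X * sin (polar_angle X) * cos (meridian_angle X) = cx X /\
  Defs.radius X * sin (polar_angle X) * sin (meridian_angle X) = cy X.
  by rewrite -[in RHS]XE -[X in _ /\ _ = cy X]XE /spherical_point !coord_vec3.
rewrite /ansatz /spherical_field !mul0r !scale0r !add0r.
set r := Defs.radius X * sin (polar_angle X) in rE r0 xE yE *.
have powE : axis_dist2 X `^ (- (b + 1) / 2) = (r `^ b)^-1 * r^-1.
  (* With the factor 1/2 in front, [powRrM] isolates s^(1/2) = r. *)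
  rewrite [- _ / 2](_ : _ = 2^-1 * - (b + 1)); last by rewrite mulrC.
  rewrite powRrM powR12_sqrt ?ltW// -rE powRN powRD ?(gt_eqF r0) ?implybT//.
  by rewrite powRr1 ?ltW// invfM.
have rb0 : r `^ b != 0 by rewrite gt_eqF// powR_gt0.
have rn0 : r != 0 by rewrite gt_eqF.
rewrite /swirl /e_meridian powE -xE -yE.
by apply: eq_row3; rewrite !(coordD, coordZ, coord_vec3); field; rewrite ?rn0 ?rb0.
Qed.

End Rotation.

(** * The Euler equations *)

Theorem mainTheorem2 (K : realType) (b C_omega : K) (hb : 0 < b)
    (hC : C_omega != 0) :
  exists p : 'rV[K]_3 -> K,
    steady_euler_on (@upper_region K)
      (ansatz b (fun _ => 0) (fun _ => 0) (fun _ => C_omega)) p.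
Proof.
(* The constant c solves c * (-b) * 2 = [C_omega]^2, so that the gradient of c s^(-b) is [C_omega]^2
   s^(-b-1) (x, y, 0). *)
pose k : K := - (b + 1) / 2; pose c := - C_omega ^+ 2 / (2 * b).
exists (fun X => c * axis_dist2 X `^ (- b)).
have dv X : off_axis X -> is_diff X (ansatz b (fun _ => 0) (fun _ => 0)
    (fun _ => C_omega)) (swirl_diff C_omega k X).
  (* The two fields agree on the open set [off_axis], hence near X, also when X lies on the cut of
     the meridian angle. *)
  move=> UX; apply: near_eq_is_diff (is_diff_swirl C_omega k X UX).
  near=> Y; apply/esym/ansatz_swirl.
  by near: Y; exact: open_nbhs_nbhs (conj open_off_axis UX).
split.
- apply: C1_on_is_diff open_off_axis upper_region_off_axis dv _ => X i.
  exact: continuous_swirl_diff.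
- apply: C1_on_is_diff open_off_axis upper_region_off_axis
    (is_diff_scaled_powR c (- b)) _ => X i.
  exact: continuous_scaled_powR_diff.
move=> X /upper_region_off_axis UX.
have dp := is_diff_scaled_powR c (- b) X UX.
have dvX := dv X UX.
have s0 : axis_dist2 X != 0 by rewrite gt_eqF.
split.
- rewrite /advection sum_ord3 !(partial_is_diff _ _ _ _ dvX) ansatz_swirl//.
  have cE : c * (- b * 2) = C_omega ^+ 2.
    by rewrite /c; field; rewrite gt_eqF.
  (* Since -b - 1 = 2k, the pressure gradient carries the same power of s as the quadratic advection
     term. *)
  have powE : axis_dist2 X `^ (- b - 1) = axis_dist2 X `^ k * axis_dist2 X `^ k.
    by rewrite -powRD ?s0 ?implybT//; congr (_ `^ _); rewrite /k; field.
  have gE i : gradient (fun Y => c * axis_dist2 Y `^ (- b)) X 0 i =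
      C_omega ^+ 2 * (axis_dist2 X `^ k * axis_dist2 X `^ k) *
      (cx X * cx (delta_mx 0 i) + cy X * cy (delta_mx 0 i)).
    rewrite mxE (partial_is_diff _ _ _ _ dp) /scaled_powR_diff /axis_dist2_diff.
    by rewrite powE -cE; ring.
  rewrite -[swirl _ _ _ 0 (inord 0)]/(cx (swirl _ _ _)).
  rewrite -[swirl _ _ _ 0 (inord 1)]/(cy (swirl _ _ _)).
  rewrite -[swirl _ _ _ 0 (inord 2)]/(cz (swirl _ _ _)).
  rewrite /swirl /swirl_diff /scaled_powR_diff /axis_dist2_diff.
  (* In the advection the derivatives of s^k enter through x (-y) + y x = 0, so only the derivative
     of the rotation (-y, x, 0) remains. *)
  apply: eq_row3; rewrite coordN ?[cx (gradient _ _)]gE ?[cy (gradient _ _)]gE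
    ?[cz (gradient _ _)]gE !delta_vec3 !(coordD, coordZ, coord_vec3); ring.
- rewrite /divergence sum_ord3.
  rewrite !(partial_is_diff _ _ _ _ (is_diff_component _ dvX)).
  rewrite -[swirl_diff _ _ _ _ 0 (inord 0)]/(cx (swirl_diff _ _ _ _)).
  rewrite -[swirl_diff _ _ _ _ 0 (inord 1)]/(cy (swirl_diff _ _ _ _)).
  rewrite -[swirl_diff _ _ _ _ 0 (inord 2)]/(cz (swirl_diff _ _ _ _)).
  rewrite /swirl_diff /scaled_powR_diff /axis_dist2_diff.
  (* The diagonal derivatives of (-y, x, 0) vanish, and those of s^k contribute multiples of -x y
     and y x that cancel. *)
  rewrite !(coordD, coordZ, coord_vec3) !delta_vec3 !coord_vec3.
  ring.
Unshelve. all: by end_near. Qed.
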